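(* There is a $d>0$ such that for any $n>n_0$ (where $n_0$ is the threshold specified in the context) the following holds. On an alphabet of size $\sigma$, the simple (non-compact) suffix tree of a random string $S$ of length $n$ has at least $d\cdot n^2$ nodes in expectation.
   Context: An alphabet $\Sigma$ is a set of different characters, and its size is denoted by $\sigma$. A string is over $\Sigma$ if each of its characters is in $\Sigma$. A random string of length $n$ on an alphabet of size $\sigma$ is one chosen uniformly among the $\sigma^n$ strings of length $n$. For a string $S$ of length $n$, $S[i]$ is its $i$th character, and $S[i,j]$ is the substring from $S[i]$ to $S[j]$ if $j \ge i$, and the empty string otherwise. The symbol $\$$ is not a character of $S$. The simple (non-compact) suffix tree of $S$ is the rooted tree, with edges directed from the root towards the leaves, with $n$ leaves numbered $1,\dots,n$, in which each edge is labelled by a single character (a character of $S$ or $\$$), the edges leaving a given node have different labels, and for each $j$ the concatenation of the edge labels along the path from the root to leaf $j$ is $S[j,n]$ followed by $\$$. The growth $\gamma(S)$ of $S$ is one less than the shortest distance (number of edges) to leaf $1$ from an internal node $v$ on the path from the root to leaf $1$ that has at least two children; that is, it counts the internal nodes different from $v$ on the path from $v$ to leaf $1$. For example, $\gamma(aabccb)=5$. The number $n_0$ is the one from a preceding theorem of the same paper, which asserts that there are $c>0$ and $n_0$ such that for any $n>n_0$: if $S'$ is a string of length $n-1$ and $S$ is obtained from $S'$ by adding to its beginning a character chosen uniformly at random from the alphabet, then the expected growth of $S$ is at least $c\cdot n$.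
   Formalization: The alphabet is required to have size at least 2; for an alphabet of size 1 the only string of length n has a simple suffix tree with 2n+1 nodes, so the claimed quadratic bound fails. *)

(* Defs.v *)
From HB Require Import structures.
From mathcomp Require Import all_boot all_order all_algebra zify.

Set Implicit Arguments.
Unset Strict Implicit.
Unset Printing Implicit Defensive.

Import Order.TTheory GRing.Theory Num.Theory.

Local Open Scope ring_scope.

(* S[j,n] followed by $, for 1 <= j <= n = size S. Characters of S are encoded
   as Some x, and $ as None. *)
Definition terminated_suffix (Sigma : Type) (S : seq Sigma) (j : nat) :
    seq (option Sigma) :=
  rcons [seq Some x | x <- drop j.-1 S] None.

(* The simple (non-compact) suffix tree of S, determined by this specification
   only up to isomorphism. st_edge u v holds when there is an edge directed from
   u to v, and then st_label u v is its label (st_label is irrelevant on other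
   pairs). st_arborescence is the rooted tree condition: every node is reached
   from the root by exactly one directed walk. Only the values of st_leaf at
   1, ..., size S are relevant. There is no leaf for the empty suffix, hence no
   such tree for the empty string. *)
Record suffix_tree (Sigma : finType) (S : seq Sigma) := SuffixTree {
  st_node :> finType;
  st_root : st_node;
  st_edge : rel st_node;
  st_label : st_node -> st_node -> option Sigma;
  st_leaf : nat -> st_node;
  st_arborescence : forall v,
    exists! p : seq st_node, path st_edge st_root p /\ last st_root p = v;
  st_label_inj : forall u v w, st_edge u v -> st_edge u w ->
    st_label u v = st_label u w -> v = w;
  st_leafP : forall v, (forall w, ~~ st_edge v w) <->
    exists2 j, (1 <= j <= size S)%N & v = st_leaf j;
  st_leaf_inj : forall i j, (1 <= i <= size S)%N -> (1 <= j <= size S)%N ->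
    st_leaf i = st_leaf j -> i = j;
  st_leaf_word : forall j, (1 <= j <= size S)%N ->
    exists p : seq st_node, [/\ path st_edge st_root p,
      last st_root p = st_leaf j
      & pairmap st_label st_root p = terminated_suffix S j]
}.

(* Least number of edges of a directed walk from u to v; the junk value #|T|
   is returned when there is none. *)
Definition edge_dist (T : finType) (e : rel T) (u v : T) : nat :=
  find (fun k => [exists p : k.-tuple T, path e u p && (last u p == v)])
       (iota 0 #|T|).

(* v is an internal node on the path from the root to leaf 1, with at least two
   children. *)
Definition branching_above_leaf1 (Sigma : finType) (S : seq Sigma)
    (T : suffix_tree S) (v : T) : bool :=
  [&& connect (@st_edge _ _ T) (st_root T) v,
      connect (@st_edge _ _ T) v (st_leaf T 1)
    & (2 <= #|[set w | st_edge v w]|)%N].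

(* If size S >= 2, the lowest common ancestor of leaves 1 and 2 satisfies
   branching_above_leaf1. If size S = 1, no node does: growth is then
   mathematically undefined, and has a junk value. *)
Definition growth (Sigma : finType) (S : seq Sigma) (T : suffix_tree S) : nat :=
  (\big[minn/#|T|]_(v : T | branching_above_leaf1 v)
     edge_dist (@st_edge _ _ T) v (st_leaf T 1)).-1.

(* Expectation of f under the uniform distribution on T. *)
Definition uniform_expectation (R : realFieldType) (T : finType) (f : T -> R) : R :=
  (\sum_(x : T) f x) / #|T|%:R.

(* n0 is a threshold from which a random character prepended to an arbitrary
   string of length n - 1 yields an expected growth at least linear in n.
   The constants do not depend on the alphabet. A one-letter alphabet has to be
   excluded, since the growth of a ^ n is 1; n0 >= 1 excludes strings of
   length 1, whose growth is undefined. *)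
Definition growth_threshold (R : realFieldType) (n0 : nat) : Prop :=
  (1 <= n0)%N /\
  exists2 c : R, 0 < c &
    forall n : nat, (n0 < n)%N ->
    forall Sigma : finType, (2 <= #|Sigma|)%N ->
    forall (S' : n.-1.-tuple Sigma) (T : forall x : Sigma, suffix_tree (x :: S')),
      c * n%:R <= uniform_expectation (fun x : Sigma => (growth (T x))%:R : R).

Section Existence.
Variables (Sigma : finType) (S : seq Sigma).
Hypothesis S_gt0 : (0 < size S)%N.

Local Notation word := (seq (option Sigma)).

Let factors : seq word :=
  [seq take k (terminated_suffix S j) | j <- iota 1 (size S), k <- iota 0 (size S).+2].

Let size_suf j : (1 <= j)%N -> (j <= size S)%N ->
  size (terminated_suffix S j) = (size S - j).+2.
Proof. by case: j => // j _ jS; rewrite size_rcons size_map size_drop /= subnSK. Qed.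

Let factorsP w : reflect
  (exists j, [/\ (1 <= j)%N, (j <= size S)%N & prefix w (terminated_suffix S j)])
  (w \in factors).
Proof.
apply: (iffP idP).
  case/allpairsP => -[j k] [/=]; rewrite !mem_iota => /andP[j1 jS] _ ->.
  by exists j; split=> //; exact: prefix_take.
case=> j [j1 jS]; rewrite prefixE => /eqP <-.
have szs := size_suf j1 jS.
rewrite -{1}(take_size (terminated_suffix S j)) -take_min.
apply/allpairsP; exists (j, minn (size w) (size (terminated_suffix S j))).
by rewrite !mem_iota szs; split=> //=; lia.
Qed.

Let node : finType := seq_sub factors.

Let nil_factor : [::] \in factors.
Proof. by apply/factorsP; exists 1%N; rewrite prefix0s. Qed.

Let root : node := SeqSub nil_factor.
Let edge : rel node := fun u v => val v == rcons (val u) (last None (val v)).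
Let label (u v : node) : option Sigma := last None (val v).
Let leaf (j : nat) : node := insubd root (terminated_suffix S j).

Let factor_rconsl w a : rcons w a \in factors -> w \in factors.
Proof.
case/factorsP=> j [j1 jS pw]; apply/factorsP; exists j; split=> //.
exact: prefix_trans (prefix_rcons _ _) pw.
Qed.

Let val_leaf j : (1 <= j <= size S)%N -> val (leaf j) = terminated_suffix S j.
Proof.
case/andP=> j1 jS; rewrite val_insubd ifT //.
by apply/factorsP; exists j; rewrite prefix_refl.
Qed.

Let walk_word u p : path edge u p -> val (last u p) = val u ++ pairmap label u p.
Proof.
elim: p u => [|v p IH] u /=; first by rewrite cats0.
by case/andP=> /eqP uv /IH ->; rewrite {1}uv cat_rcons.
Qed.

Let edge_rcons (u v : node) a : val v = rcons (val u) a -> edge u v.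
Proof. by move=> e; rewrite /edge e last_rcons. Qed.

Let walk_exists v : exists p, path edge root p /\ last root p = v.
Proof.
case: v => w; elim/last_ind: w => [|w a IH] wF.
  by exists [::]; split=> //; apply: val_inj.
have [p [pp lp]] := IH (factor_rconsl wF).
exists (rcons p (SeqSub wF)); rewrite rcons_path last_rcons pp lp; split=> //=.
exact: (@edge_rcons _ _ a).
Qed.

Let walk_unique p q : path edge root p -> path edge root q ->
  last root p = last root q -> p = q.
Proof.
have noin u : ~~ edge u root by rewrite /edge /=; case: (val u).
elim/last_ind: p q => [|p v IH] q.
  case/lastP: q => // q u _; rewrite rcons_path last_rcons /= => /andP[_ e] r.
  by move: e; rewrite -r (negPf (noin _)).
case/lastP: q => [|q u].
  rewrite rcons_path last_rcons /= => /andP[_ e] _ r.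
  by move: e; rewrite r (negPf (noin _)).
rewrite !rcons_path !last_rcons => /andP[pp e1] /andP[pq e2] uv.
move: e2; rewrite -uv => e2; congr rcons; apply: IH => //.
apply: val_inj; move: e1 e2 => /eqP e1 /eqP; rewrite {1}e1 => /eqP.
by rewrite eqseq_rcons => /andP[/eqP].
Qed.

Let leaf_spec v : (forall w, ~~ edge v w) <->
  exists2 j, (1 <= j <= size S)%N & v = leaf j.
Proof.
split=> [nov|[j jS ->] w].
  have /factorsP[j [j1 jS /prefixP[s es]]] := valP v.
  exists j; rewrite ?j1 //; apply: val_inj; rewrite val_leaf ?j1 //.
  case: s es => [|a s] es; first by rewrite es cats0.
  have wF : rcons (val v) a \in factors.
    by apply/factorsP; exists j; split=> //; rewrite es -cat_rcons prefix_prefix.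
  by have := nov (SeqSub wF); rewrite (@edge_rcons v (SeqSub wF) a).
apply/negP => /eqP; rewrite (val_leaf jS).
have idx (t : seq Sigma) (r : word) :
    index None (rcons [seq Some x | x <- t] None ++ r) = size t.
  by elim: t => //= x t ->.
have /factorsP[i [_ _ /prefixP[s es]]] := valP w.
move: (last None (val w)) => a e; move: es; rewrite e cat_rcons => es.
have := congr1 (index None) es.
rewrite -[in LHS](cats0 (terminated_suffix S i)) !idx => ei.
have := congr1 size es.
by rewrite size_cat !size_rcons !size_map ei /=; lia.
Qed.

Lemma suffix_tree_exists : inhabited (suffix_tree S).
Proof.
constructor; apply: (@SuffixTree _ _ node root edge label leaf).
- move=> v; have [p [pp lp]] := walk_exists v; exists p; split=> // q [pq lq].
  by apply: walk_unique => //; rewrite lp.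
- by move=> u v w /eqP uv /eqP uw e; apply: val_inj; rewrite uv uw -/(label u v) e.
- exact: leaf_spec.
- move=> i j iS jS /(congr1 val); rewrite !val_leaf // => /(congr1 size).
  move: iS jS => /andP[i1 iS] /andP[j1 jS]; rewrite !size_suf // => -[].
  by move/(congr1 (subn (size S))); rewrite !subKn.
- move=> j jS; have [p [pp lp]] := walk_exists (leaf j); exists p; split=> //.
  by have := walk_word pp; rewrite lp val_leaf.
Qed.

End Existence.

(* Main.v *)
Require Import Defs.
From mathcomp Require Import all_boot all_order all_algebra.
From mathcomp Require Import zify.

Set Implicit Arguments.
Unset Strict Implicit.
Unset Printing Implicit Defensive.

Import Order.TTheory GRing.Theory Num.Theory.

Local Open Scope ring_scope.

(** Nodes of the suffix tree are words read from the root, so the count is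
    governed by how many prefixes of each suffix do not already occur further
    to the right. Call a nonempty prefix of [s] new when it is not a factor of
    [behead s], and let g be the number of new prefixes ([new_prefixes]).

    The combinatorial core concerns a string [s] of length m in front of which
    a letter is put. If fewer than half of the prefixes of [x :: s] are new, a
    prefix of length greater than (m + 1) / 2 occurs again at a shift p smaller
    than half the length. If another letter [y] had a shift q in the same way,
    the two strings agree except in position 0, and comparing positions p, p + q
    and q gives x = y ([few_new_prefixes_inj]). So at most one letter is bad,
    all others give g >= (m + 1) / 2, and with at least two letters the mean of
    g is at least (m + 1) / 4 ([sum_new_prefixes]).

    This yields both conclusions. A branching node at depth D above leaf 1
    spells a word that starts a second suffix, so the prefixes of length at
    most D are not new and the path from that node down to the leaf has more
    than g edges: growth is at least g ([new_prefixes_growth]), and 1 is a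
    growth threshold with constant 1/4. On the other hand, the new prefixes of
    all the suffixes are pairwise distinct factors and each one is spelled by
    a node ([factors_card]). In a random string each suffix consists of a
    random letter before a string independent of it, so the expected number of
    these factors is at least the sum of k / 4 for k <= n, hence at least
    n ^ 2 / 8 ([sum_factors]). *)

(** * Prefixes that do not occur again *)

Section Factors.
Local Open Scope nat_scope.
Variable A : eqType.
Implicit Types s w : seq A.

Definition new_prefixes s : seq (seq A) :=
  [seq take l s | l <- iota 1 (size s) & ~~ infix (take l s) (behead s)].

(** The nonempty factors of [s], each listed once, at its rightmost
    occurrence. *)
Fixpoint factors s : seq (seq A) :=
  if s is _ :: s' then new_prefixes s ++ factors s' else [::].

Lemma factors_sound s w : w \in factors s -> (w != [::]) && infix w s.
Proof.
elim: s => //= x s IH; rewrite mem_cat => /orP[|/IH/andP[-> ws]]; last first.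
  by rewrite ws orbT.
case/mapP=> l; rewrite mem_filter mem_iota => /andP[_ /andP[l1 _]] ->.
by case: l l1 => // l _ /=; rewrite eqxx prefix_take.
Qed.

Lemma factors_uniq s : uniq (factors s).
Proof.
elim: s => // x s IH; rewrite [factors _]/= cat_uniq IH andbT; apply/andP; split.
  rewrite map_inj_in_uniq ?filter_uniq ?iota_uniq //.
  move=> i j; rewrite !mem_filter !mem_iota => /andP[_ Hi] /andP[_ Hj].
  by move/(congr1 size); rewrite !size_take_min; lia.
apply/hasPn => w /factors_sound/andP[_ ws]; apply/mapP => -[l].
by rewrite mem_filter => /andP[/negP nw _] e; apply: nw; rewrite -e.
Qed.

(** Bounds the number of new prefixes from one branching node: its depth serves
    as [D]. *)
Lemma size_new_prefixes_le s D :
  D <= size s -> (forall l, 0 < l <= D -> infix (take l s) (behead s)) ->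
  size (new_prefixes s) <= size s - D.
Proof.
move=> Ds old; rewrite size_map size_filter.
rewrite -{1}(subnKC Ds) iotaD count_cat (@eq_in_count _ _ pred0).
  by rewrite count_pred0 (leq_trans (count_size _ _)) ?size_iota.
by move=> l; rewrite mem_iota => ll /=; rewrite old //; lia.
Qed.

(** If all the prefixes in the longer half were new, they would already be too
    many. *)
Lemma long_old_prefix s : 2 * size (new_prefixes s) < size s ->
  exists2 l, (size s < 2 * l) & (l <= size s) && infix (take l s) (behead s).
Proof.
move=> few; set h := (size s)./2.
have hE : h <= size s by rewrite /h; lia.
have [/hasP[l]|/hasPn none] := boolP (has (fun l => infix (take l s) (behead s))
    (iota (1 + h) (size s - h))).
  by rewrite mem_iota => ll il; exists l; rewrite ?il ?andbT; lia.
suff : size s - h <= size (new_prefixes s) by lia.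
rewrite size_map size_filter -{2}(subnKC hE) iotaD count_cat.
apply: leq_trans (leq_addl _ _); rewrite -{1}(size_iota (1 + h) (size s - h)).
by rewrite leq_eqVlt eq_sym -all_count; apply/orP; left; apply/allP.
Qed.

(** A second occurrence of a prefix is a period [p] of an initial segment; the
    inequality [p + l <= size s] makes the period short when the prefix is
    long. *)
Lemma infix_shift x0 s l : 0 < l <= size s -> infix (take l s) (behead s) ->
  exists p, [/\ 0 < p, p + l <= size s &
    forall i, i < l -> nth x0 s i = nth x0 s (p + i)].
Proof.
move=> ls /infixP[u [v e]]; exists (size u).+1.
have es := congr1 size e; rewrite !size_cat size_behead size_takel in es; last by lia.
split=> // [|i il]; first by lia.
have := congr1 (fun t => nth x0 t (size u + i)) e.
rewrite nth_behead -addSn => ->; rewrite nth_cat ltnNge leq_addr /= addKn nth_cat.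
by rewrite size_takel ?il ?nth_take //; lia.
Qed.

(** The periods p and q obtained for the two letters are each shorter than the
    range on which the other one is valid. As the strings u = x :: s and
    v = y :: s agree off position 0, this gives
    x = u(0) = u(p) = v(p) = v(p + q) = u(p + q) = u(q) = v(q) = v(0) = y. *)
Lemma few_new_prefixes_inj s x y :
  2 * size (new_prefixes (x :: s)) < (size s).+1 ->
  2 * size (new_prefixes (y :: s)) < (size s).+1 -> x = y.
Proof.
move=> /(@long_old_prefix (x :: s))[l /= l2 /andP[ls lx]].
move=> /(@long_old_prefix (y :: s))[m /= m2 /andP[ms my]].
have [||p [p0 pl px]] := @infix_shift x (x :: s) l => //; first by rewrite /=; lia.
have [||q [q0 qm qy]] := @infix_shift x (y :: s) m => //; first by rewrite /=; lia.
rewrite /= in pl qm.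
have tailE i : 0 < i -> nth x (x :: s) i = nth x (y :: s) i by case: i.
have -> : x = nth x (x :: s) p by rewrite -[p]addn0 -px //; lia.
have -> : y = nth x (x :: s) q by rewrite tailE // -[q]addn0 -qy //; lia.
rewrite (px q) 1?addnC; last by lia.
by rewrite tailE // (qy p) 1?tailE //; lia.
Qed.

End Factors.

(** At most one letter is bad, and it is at most half of the alphabet; each of
    the others contributes at least half the length. *)
Lemma sum_new_prefixes (Sigma : finType) (s : seq Sigma) : (2 <= #|Sigma|)%N ->
  (#|Sigma| * (size s).+1 <= 4 * \sum_(x : Sigma) size (new_prefixes (x :: s)))%N.
Proof.
move=> sigma2.
pose few x := (2 * size (new_prefixes (x :: s)) < (size s).+1)%N.
have few1 : (#|few| <= 1)%N.
  by apply/card_le1P => x fx y; rewrite inE; apply/idP/eqP => [fy|->//];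
     apply: few_new_prefixes_inj fy fx.
have compl : (#|few| + #|[predC few]| = #|Sigma|)%N by exact: cardC.
suff : (#|[predC few]| * (size s).+1 <= \sum_x 2 * size (new_prefixes (x :: s)))%N.
  have half : (#|Sigma| <= 2 * #|[predC few]|)%N by rewrite -compl; lia.
  rewrite -big_distrr /= => le2; apply: leq_trans (leq_mul half (leqnn _)) _.
  by rewrite -mulnA -[4%N]/(2 * 2)%N -(mulnA 2 2) leq_pmul2l.
rewrite -sum_nat_const [leqRHS](bigID [predC few]) /=; apply: leq_trans (leq_addr _ _).
by apply: leq_sum => x; rewrite !inE /few -leqNgt.
Qed.

(** * Words spelled in a suffix tree *)

Section Tree.
Variables (Sigma : finType) (S : seq Sigma) (T : suffix_tree S).
Let root := st_root T.
Let edge : rel T := @st_edge _ _ T.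
Let label := @st_label _ _ T.

Lemma root_walk_inj p q :
  path edge root p -> path edge root q -> last root p = last root q -> p = q.
Proof.
move=> pp pq e; have [r [_ ru]] := st_arborescence (last root q).
by rewrite -(ru p) ?(ru q).
Qed.

Fact walk_to_ex (v : T) : exists p, path edge root p && (last root p == v).
Proof. by have [p [[pp lp] _]] := st_arborescence v; exists p; rewrite pp lp eqxx. Qed.

Definition walk_to (v : T) : seq T := xchoose (walk_to_ex v).

Lemma walk_toP v : path edge root (walk_to v) /\ last root (walk_to v) = v.
Proof. by have /andP[? /eqP] := xchooseP (walk_to_ex v). Qed.

Lemma walk_to_last p : path edge root p -> walk_to (last root p) = p.
Proof. by move=> pp; have [? ?] := walk_toP (last root p); apply: root_walk_inj. Qed.

Definition node_word (v : T) : seq (option Sigma) := pairmap label root (walk_to v).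

Lemma take_pairmap (A B : Type) (f : A -> A -> B) x p l :
  take l (pairmap f x p) = pairmap f x (take l p).
Proof. by elim: p x l => [|y p IH] x [|l] //=; rewrite IH. Qed.

(** An occurrence of [w] starts some suffix, and the walk to the leaf of that
    suffix spells [w] on its way. The empty word is placed at the first
    suffix because there is no leaf for the empty one. *)
Lemma infix_node_word w : (0 < size S)%N -> infix w S ->
  exists v : T, node_word v = [seq Some x | x <- w].
Proof.
move=> S0 wS.
have [j jS [t e]] : exists2 j, (1 <= j <= size S)%N & exists t, drop j.-1 S = w ++ t.
  case/infixP: wS => u [t e].
  have [->|w0] := eqVneq w [::]; first by exists 1%N; [lia | exists S; rewrite drop0].
  exists (size u).+1; last by exists t; rewrite e drop_size_cat.
  by have := congr1 size e; case: (w) w0 => // ? ? _; rewrite !size_cat /=; lia.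
have [p [pp lp wp]] := @st_leaf_word _ _ T j jS.
exists (last root (take (size w) p)).
rewrite /node_word walk_to_last; last first.
  by move: pp; rewrite -{1}(cat_take_drop (size w) p) cat_path => /andP[].
rewrite -take_pairmap wp /terminated_suffix e map_cat -cats1 -catA.
by rewrite take_cat size_map ltnn subnn take0 cats0.
Qed.

(** The inequality is strict because the root spells the empty word, which is
    not among the factors listed. *)
Lemma factors_card : (0 < size S)%N -> (size (factors S) < #|T|)%N.
Proof.
move=> S0; rewrite cardE.
rewrite -(size_map node_word) -(size_map (map Some) (factors S)).
apply: (@uniq_leq_size _ ([::] :: map (map Some) (factors S))).
  rewrite /= map_inj_uniq ?factors_uniq ?andbT; last by apply: inj_map => ? ? [].
  by apply/mapP => -[[|//]] /factors_sound.
have words w : infix w S -> map Some w \in map node_word (enum T).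
  by move=> /(infix_node_word S0)[v <-]; rewrite map_f ?mem_enum.
move=> w; rewrite inE => /predU1P[->|]; first by rewrite (words [::]) ?infix0s.
by case/mapP=> u /factors_sound/andP[_ uS] ->; apply: words.
Qed.

(** Cutting the loops out of a walk from the root would give a second walk to
    the same node. *)
Lemma root_walk_uniq p : path edge root p -> uniq (root :: p).
Proof.
move=> pp; have [q [pq uq lq]] : exists q,
    [/\ path edge root q, uniq (root :: q) & last root q = last root p].
  by case/shortenP: pp => q pq uq _; exists q.
by rewrite -(root_walk_inj pq pp lq).
Qed.

(** A walk from the root repeats no node, so it cannot be extended for ever. *)
Lemma extend_to_leaf p : path edge root p -> exists j q,
  [/\ (1 <= j <= size S)%N, path edge root (p ++ q) & last root (p ++ q) = st_leaf T j].
Proof.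
move=> pp; have [m] := ubnP (#|T| - size p)%N; elim: m p pp => // m IH p pp pm.
have p_lt : (size p < #|T|)%N.
  by have := max_card (mem (root :: p)); rewrite (card_uniqP (root_walk_uniq pp)).
have [/existsP[w ew]|/existsPn none] := boolP [exists w, edge (last root p) w].
  have [||j [q [jS pq lq]]] := IH (rcons p w); first by rewrite rcons_path pp.
    by rewrite size_rcons; lia.
  by exists j, (w :: q); rewrite -cat_rcons.
have [j jS lj] := (st_leafP (last root p)).1 none.
by exists j, [::]; rewrite cats0.
Qed.

(** Below [v], leave the walk to leaf 1 through another child and continue to
    a leaf [j]. The word of [v] then starts both the whole string and its
    suffix at [j > 1], so none of its prefixes is new; the walk to leaf 1 has
    [size S + 1] edges, of which [k] are below [v]. *)
Lemma branching_far v k : (0 < size S)%N -> branching_above_leaf1 v ->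
  (exists p : k.-tuple T, path edge v p && (last v p == st_leaf T 1)) ->
  (size (new_prefixes S) < k)%N.
Proof.
move=> S0 /and3P[_ _ /card_gt1P[w1 [w2 [+ + w12]]]].
rewrite !inE => e1 e2 [p /andP[pp /eqP lp]].
have S1 : (1 <= 1 <= size S)%N by rewrite S0.
have [pv lv] := walk_toP v; set q := walk_to v in pv lv.
have [w ew wp] : exists2 w, edge v w & ohead p != Some w.
  have [e|] := eqVneq (ohead p) (Some w1); last by exists w1.
  by exists w2 => //; rewrite e; apply: contra w12 => /eqP[->].
have [j [r [jS pr lr]]] : exists j r, [/\ (1 <= j <= size S)%N,
    path edge root (q ++ w :: r) & last root (q ++ w :: r) = st_leaf T j].
  have [|j [r]] := @extend_to_leaf (rcons q w); first by rewrite rcons_path pv lv.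
  by rewrite cat_rcons; exists j, r.
have pqp : path edge root (q ++ p) by rewrite cat_path pv lv.
have lqp : last root (q ++ p) = st_leaf T 1 by rewrite last_cat lv.
(* leaf 1 has no child, so it is not [v] *)
have k0 : (0 < k)%N.
  rewrite -(size_tuple p) lt0n size_eq0; apply: contraTneq e1 => p0.
  move: lp; rewrite p0 /= => ->.
  by apply: (proj2 (st_leafP (st_leaf T 1))); exists 1%N.
have j1 : j != 1%N.
  apply: contraNneq wp => j1; rewrite j1 -lqp in lr.
  have /eqP := root_walk_inj pr pqp lr.
  by rewrite eqseq_cat // eqxx => /eqP <-.
have wordE i s : (1 <= i <= size S)%N -> path edge root (q ++ s) ->
    last root (q ++ s) = st_leaf T i ->
    pairmap label root (q ++ s) = terminated_suffix S i.
  move=> iS ps ls; have [t [pt lt <-]] := @st_leaf_word _ _ T i iS.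
  by congr pairmap; apply: root_walk_inj => //; rewrite ls.
have szE i s : (1 <= i <= size S)%N ->
    pairmap label root (q ++ s) = terminated_suffix S i ->
    (size q + size s = (size S - i).+2)%N.
  move=> iS /(congr1 size); rewrite size_pairmap size_cat size_rcons size_map size_drop; lia.
have W1 := wordE _ _ S1 pqp lqp; have Wj := wordE _ _ jS pr lr.
have := szE _ _ S1 W1; have := szE _ _ jS Wj; rewrite size_tuple /= => sj s1.
have takeE i s : (size q <= (size S - i).+1)%N -> (1 <= i <= size S)%N ->
    pairmap label root (q ++ s) = terminated_suffix S i ->
    [seq Some x | x <- take (size q) (drop i.-1 S)] = pairmap label root q.
  move=> iq iS /(congr1 (take (size q))).
  rewrite take_pairmap take_size_cat // => ->.
  rewrite /terminated_suffix -cats1 takel_cat ?map_take //.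
  by rewrite size_map size_drop; lia.
have common : take (size q) S = take (size q) (drop j.-1 S).
  have injS : injective (@Some Sigma) by move=> ? ? [].
  apply: (inj_map injS); rewrite (takeE j (w :: r)) //; last by lia.
  by rewrite -[S in take _ S]drop0 (takeE 1%N p) //; lia.
have qS : (size q <= size S)%N by lia.
have lt_k : (size S - size q < k)%N by lia.
apply: leq_ltn_trans lt_k; apply: size_new_prefixes_le => // l lq.
have -> : take l S = take l (drop j.-1 S).
  by rewrite -(@take_takel _ l (size q)) ?common ?take_takel //; lia.
have -> : drop j.-1 S = drop j.-2 (behead S).
  by rewrite -drop1 drop_drop; congr drop; lia.
apply: infix_trans (infix_take _ _) (infix_drop _ _).
Qed.

(** Growth is one less than a minimum whose default is the number of nodes,
    as is the distance of disconnected nodes. That default is itself larger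
    than the number of new prefixes, so neither junk value breaks the bound. *)
Lemma new_prefixes_growth : (0 < size S)%N -> (size (new_prefixes S) <= growth T)%N.
Proof.
move=> S0; have ltT : (size (new_prefixes S) < #|T|)%N.
  apply: leq_ltn_trans (factors_card S0).
  by case: (S) S0 => //= x s _; rewrite size_cat leq_addr.
suff : (size (new_prefixes S) <
    \big[minn/#|T|]_(v : T | branching_above_leaf1 v) edge_dist edge v (st_leaf T 1))%N.
  by rewrite /growth -/edge; lia.
elim/big_rec: _ => // v m bv lt_m; rewrite leq_min lt_m andbT /edge_dist.
set P := (X in find X); have [hasP|/hasNfind ->] := boolP (has P (iota 0 #|T|)).
  apply: (@branching_far v) => //; have := nth_find 0%N hasP.
  rewrite nth_iota; first by rewrite add0n => /existsP.
  by rewrite -[X in (_ < X)%N](size_iota 0) -has_find.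
by rewrite size_iota.
Qed.

End Tree.

(** * Averaging over the letters *)

Lemma sum_tuple_cons (A : finType) n (f : seq A -> nat) :
  (\sum_(t : n.+1.-tuple A) f t = \sum_(t : n.-tuple A) \sum_(x : A) f (x :: t))%N.
Proof.
rewrite pair_big /= (reindex (fun p : n.-tuple A * A => [tuple of p.2 :: p.1])) //=.
exists (fun t : n.+1.-tuple A => ([tuple of behead t] : n.-tuple A, thead t)) =>
  [[t x]|t] _ /=.
  by congr pair; apply: val_inj.
by rewrite [RHS]tuple_eta.
Qed.

(** By induction on [n]: prepending a letter adds exactly its new prefixes, and
    [sum_new_prefixes] bounds their mean for every fixed tail. *)
Lemma sum_factors (Sigma : finType) n : (2 <= #|Sigma|)%N ->
  (#|Sigma| ^ n * n ^ 2 <= 8 * \sum_(S : n.-tuple Sigma) size (factors S))%N.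
Proof.
move=> sigma2.
suff : (#|Sigma| ^ n * \sum_(k < n.+1) k <=
        4 * \sum_(S : n.-tuple Sigma) size (factors S))%N.
  have : (n ^ 2 <= 2 * \sum_(k < n.+1) k)%N.
    elim: n => // n IH.
    have -> : (n.+1 ^ 2 = n ^ 2 + 2 * n.+1 - 1)%N by rewrite -!mulnn; lia.
    by rewrite big_ord_recr mulnDr (leq_trans (leq_subr 1 _)) // leq_add2r.
  by nia.
elim: n => [|n IH]; first by rewrite big_ord_recr big_ord0 muln0.
rewrite (sum_tuple_cons _ (fun s => size (factors s))) big_ord_recr /= expnS.
have step (t : n.-tuple Sigma) : (\sum_(x : Sigma) size (factors (x :: t)) =
    \sum_(x : Sigma) size (new_prefixes (x :: t)) + #|Sigma| * size (factors t))%N.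
  by rewrite -sum_nat_const -big_split; apply: eq_bigr => x _; apply: size_cat.
rewrite (eq_bigr _ (fun t _ => step t)) big_split /= -big_distrr /=.
have : (#|Sigma| ^ n * (#|Sigma| * n.+1) <=
    4 * \sum_(t : n.-tuple Sigma) \sum_(x : Sigma) size (new_prefixes (x :: t)))%N.
  rewrite -card_tuple -sum_nat_const big_distrr /=; apply: leq_sum => t _.
  by have := @sum_new_prefixes Sigma t sigma2; rewrite size_tuple.
move=> new_le; rewrite !mulnDr addnC leq_add //.
  by rewrite (mulnC #|Sigma|) -mulnA.
by rewrite -mulnA (mulnCA 4) leq_mul2l IH orbT.
Qed.

Lemma growth_threshold1 (R : realFieldType) : growth_threshold R 1.
Proof.
split=> //; exists (4^-1); first by rewrite invr_gt0 ltr0n.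
move=> n n1 Sigma sigma2 S' T; rewrite /uniform_expectation.
have sigma0 : 0 < #|Sigma|%:R :> R by rewrite ltr0n; lia.
rewrite ler_pdivlMr // -mulrA ler_pdivrMl ?ltr0n // -natr_sum -!natrM ler_nat.
have := @sum_new_prefixes Sigma S' sigma2; rewrite size_tuple prednK ?(ltnW n1) //.
rewrite mulnC => /leq_trans; apply; rewrite leq_mul2l /=.
by apply: leq_sum => x _; apply: new_prefixes_growth.
Qed.

Theorem theorem13 (R : realFieldType) :
  (exists n0 : nat, growth_threshold R n0) /\
  (forall n0 : nat, growth_threshold R n0 ->
   exists2 d : R, 0 < d &
     forall n : nat, (n0 < n)%N ->
     forall Sigma : finType, (2 <= #|Sigma|)%N ->
     forall T : (forall S : n.-tuple Sigma, suffix_tree S),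
       d * n%:R ^+ 2 <=
         uniform_expectation (fun S : n.-tuple Sigma => #|T S|%:R : R)).
Proof.
split=> [|n0 _]; first by exists 1%N; apply: growth_threshold1.
exists (8^-1); first by rewrite invr_gt0 ltr0n.
move=> n n0n Sigma sigma2 T; rewrite /uniform_expectation card_tuple.
rewrite ler_pdivlMr ?ltr0n ?expn_gt0; last by lia.
rewrite -mulrA ler_pdivrMl ?ltr0n // -natr_sum -natrX -!natrM ler_nat.
rewrite mulnC (leq_trans (sum_factors n sigma2)) // leq_mul2l /=.
by apply: leq_sum => S _; apply/ltnW/factors_card; rewrite size_tuple; lia.
Qed.
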